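(* Let $P\subset\mathbb{R}^3_{>0}$ be a finite set, let $B\subset\mathbb{R}^3_{>0}$ be a fixed finite nonempty baseline set, and let $k$ be an integer with $1\le k\le |P|$. Let $S_g=S_k$ be any set returned by the greedy algorithm that starts with $S_0=\emptyset$ and for $t=1,\dots,k$ sets $S_t=S_{t-1}\cup\{p_t\}$, where $$p_t\in\arg\max_{p\in P\setminus S_{t-1}}\bigl(I_B(S_{t-1}\cup\{p\})-I_B(S_{t-1})\bigr).$$ Then $$I_B(S_g)\ \ge\ \Bigl(1-\frac1e\Bigr)\max_{S\subseteq P,\ |S|\le k}I_B(S).$$
   Context: Let $\Delta_2=\{w\in\mathbb{R}^3_{\ge 0}:w_1+w_2+w_3=1\}$, with $\mathrm{d}w$ two-dimensional (unnormalized) Lebesgue measure on $\Delta_2$ in the coordinates $(w_1,w_2)$, so that $\Delta_2$ has total measure $1/2$. For $p\in\mathbb{R}^3_{>0}$ and $w\in\Delta_2$ let $g_p(w)=\max\{w_1p_1,w_2p_2,w_3p_3\}$. For a finite nonempty set $S\subset\mathbb{R}^3_{>0}$ let $\tau_S(w)=\min_{p\in S}g_p(w)$ and $R_2(S)=\int_{\Delta_2}\tau_S(w)\,\mathrm{d}w$. For $S\subseteq P$ define the improvement $I_B(S)=R_2(B)-R_2(B\cup S)$. Ties in the greedy choice are broken arbitrarily. *)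

(* Defs.v *)
From mathcomp Require Import all_boot all_order all_algebra finmap.
From mathcomp Require Import all_classical all_reals all_analysis.

Set Implicit Arguments.
Unset Strict Implicit.
Unset Printing Implicit Defensive.

Import Order.TTheory GRing.Theory Num.Theory.
Import numFieldNormedType.Exports.

Local Open Scope classical_set_scope.
Local Open Scope fset_scope.
Local Open Scope ring_scope.

Definition positive_points (R : realType) (S : {fset 'rV[R]_3}) : Prop :=
  forall p, p \in S -> forall i, 0 < p 0 i.

Definition simplex (R : realType) : set 'rV[R]_3 :=
  [set w : 'rV[R]_3 | (forall i, 0 <= w 0 i) /\ \sum_i w 0 i = 1].

(* The point of the plane w_1 + w_2 + w_3 = 1 with coordinates (w_1, w_2). *)
Definition chart (R : realType) (x : R * R) : 'rV[R]_3 :=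
  \row_i nth 0 [:: x.1; x.2; 1 - x.1 - x.2] i.

(* In the iterated maxima and minima below, the starting value is itself one
   of the values over which the extremum is taken. *)
Definition g (R : realType) (p w : 'rV[R]_3) : R :=
  \big[Num.max/w 0 0 * p 0 0]_(i < 3) (w 0 i * p 0 i).

(* [head 0 S] is an element of [S] as soon as [S] is nonempty; the value at
   the empty set is junk. *)
Definition tau (R : realType) (S : {fset 'rV[R]_3}) (w : 'rV[R]_3) : R :=
  \big[Num.min/g (head 0 S) w]_(p <- S) g p w.

Definition R2 (R : realType) (S : {fset 'rV[R]_3}) : R :=
  \int[(lebesgue_measure \x lebesgue_measure)%E]_(x in @chart R @^-1` @simplex R)
    tau S (chart x).

Definition improvement (R : realType) (B S : {fset 'rV[R]_3}) : R :=
  R2 B - R2 (B `|` S).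

(* [greedy P f t S]: [S] is a possible state after [t] rounds of greedy
   maximization of [f] over [P], ties being broken arbitrarily. *)
Inductive greedy (R : realType) (T : choiceType) (P : {fset T})
    (f : {fset T} -> R) : nat -> {fset T} -> Prop :=
| greedy0 : greedy P f 0 fset0
| greedyS t S p : greedy P f t S -> p \in P `\` S ->
    (forall q, q \in P `\` S -> f (S `|` [fset q]) - f S <= f (S `|` [fset p]) - f S) ->
    greedy P f t.+1 (S `|` [fset p]).

(* Main.v *)
(* The integrand [tau S w] is a minimum over [S], so for fixed [w] adding a
   point [p] to [X] decreases it by [a - min(a, g_p(w))] with [a = tau X w].
   This quantity is nonnegative and nondecreasing in [a], and [a] shrinks when
   [X] grows; integrating, the improvement is monotone and submodular. The rest
   is the classical Nemhauser-Wolsey-Fisher argument: for a competitor [O] with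
   at most [k] elements some element of [O] closes at least [1/k] of the gap to
   [f O], so the gap shrinks by the factor [1 - 1/k <= exp(-1/k)] each round. *)
Require Import Defs.
From mathcomp Require Import all_boot all_order all_algebra finmap.
From mathcomp Require Import all_classical all_reals all_analysis.
From mathcomp Require Import measurable_realfun lra.

Set Implicit Arguments.
Unset Strict Implicit.
Unset Printing Implicit Defensive.

Import Order.TTheory GRing.Theory Num.Theory.
Import numFieldNormedType.Exports.

Local Open Scope fset_scope.
Local Open Scope ring_scope.

(** * Greedy maximization of monotone submodular functions *)

Section GreedySubmodular.
Variables (R : realType) (T : choiceType) (f : {fset T} -> R).
Hypothesis f_mono : forall S S', S `<=` S' -> f S <= f S'.
Hypothesis f_submod : forall S S' p, S `<=` S' ->
  f (S' `|` [fset p]) - f S' <= f (S `|` [fset p]) - f S.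

(** Insert the elements of [A] one by one: by submodularity each increment is at most the gain of
    the same element over [S] alone, hence at most [M]. *)
Lemma submodular_gain_le (S A : {fset T}) (M : R) :
  (forall q, q \in A -> f (S `|` [fset q]) - f S <= M) ->
  f (S `|` A) - f S <= #|` A|%:R * M.
Proof.
suff gain_seq (s : seq T) : (forall q, q \in s -> f (S `|` [fset q]) - f S <= M) ->
    f (S `|` [fset x in s]) - f S <= (size s)%:R * M.
  move=> gainM; have := gain_seq (enum_fset A) gainM.
  by congr (f (_ `|` _) - _ <= _); apply/fsetP => x; rewrite inE.
elim: s => [|q s IHs] gainM /=.
  by rewrite fset_nil fsetU0 subrr mul0r.
have IH := IHs (fun r rs => gainM r (mem_behead (s := q :: s) rs)).
have := f_submod q (fsubsetUl S [fset x in s]).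
have := gainM q (mem_head q s).
rewrite fset_cons fsetUCA [q |` _]fsetUC -natr1 mulrDl mul1r.
lra.
Qed.

Lemma greedy_gap (P O S : {fset T}) (k t : nat) :
  (0 < k)%N -> O `<=` P -> (#|` O| <= k)%N -> greedy P f t S ->
  f O - f S <= (1 - k%:R^-1) ^+ t * (f O - f fset0).
Proof.
move=> k0 OP Ok; elim=> [|{}t {}S p _ IH pPS pmax]; first by rewrite expr0 mul1r.
have k0R : 0 < k%:R :> R by rewrite ltr0n.
set d := f (S `|` [fset p]) - f S in pmax *.
have d0 : 0 <= d by rewrite subr_ge0 f_mono// fsubsetUl.
have gap_le : f O - f S <= k%:R * d.
  apply: (@le_trans _ _ (f (S `|` O) - f S)).
    by rewrite lerD2r f_mono// fsubsetUr.
  apply: (@le_trans _ _ (#|` O|%:R * d)); last by rewrite ler_wpM2r// ler_nat.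
  (* Greedy optimality only concerns candidates outside [S]; an element of [O] already in [S] has
     gain [0 <= d]. *)
  apply: submodular_gain_le => q qO; have [qS|qNS] := boolP (q \in S).
    by rewrite (fsetUidPl _ _ _) ?fsub1set// subrr.
  by apply: pmax; rewrite inE qNS (fsubsetP OP).
have kV1 : k%:R^-1 <= 1 :> R by rewrite invf_le1// ler1n.
have -> : f O - f (S `|` [fset p]) = f O - f S - d by rewrite /d; lra.
apply: (@le_trans _ _ ((1 - k%:R^-1) * (f O - f S))).
  have : k%:R^-1 * (f O - f S) <= d by rewrite ler_pdivrMl.
  lra.
by rewrite exprS -mulrA ler_wpM2l// subr_ge0.
Qed.

Lemma greedy_submodular_bound (P O S : {fset T}) (k : nat) :
  (0 < k)%N -> f fset0 = 0 -> O `<=` P -> (#|` O| <= k)%N -> greedy P f k S ->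
  (1 - (expR 1)^-1) * f O <= f S.
Proof.
move=> k0 f0 OP Ok gr.
have gap := greedy_gap k0 OP Ok gr; rewrite f0 subr0 in gap.
have fO0 : 0 <= f O by rewrite -f0 f_mono.
have ratio_le : (1 - k%:R^-1) ^+ k <= (expR 1)^-1 :> R.
  have -> : (expR 1)^-1 = expR (- k%:R^-1) ^+ k :> R.
    by rewrite -expRM_natl mulrN mulfV ?expRN// pnatr_eq0 -lt0n.
  (* This is [1 + x <= expR x] at [x = - k%:R^-1], raised to the power [k]; the base [1 - k%:R^-1]
     is nonnegative because [1 <= k]. *)
  rewrite lerXn2r ?nnegrE ?expR_ge0 ?expR_ge1Dx//.
  by rewrite subr_ge0 invf_le1 ?ler1n ?ltr0n.
have := ler_wpM2r fO0 ratio_le; move: gap; lra.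
Qed.

End GreedySubmodular.

(** * Pointwise behaviour of [tau] *)

Section Improvement.
Variable R : realType.
Implicit Types (S A B : {fset 'rV[R]_3}) (w p : 'rV[R]_3).

(** For nonempty [S] the starting point [head 0 S] belongs to [S], so the iterated minimum is a true
    minimum. *)
Lemma le_tauP S w c : S != fset0 ->
  reflect (forall p, p \in S -> c <= g p w) (c <= tau S w).
Proof.
move=> S0; have headS : head 0 S \in (S : seq _).
  have /fset0Pn[p] := S0; have : p \in enum_fset S -> head 0 S \in enum_fset S.
    by case: (enum_fset S) => // a l _; exact: mem_head.
  exact.
apply: (iffP idP) => [ctau p pS|cg].
  by apply: le_trans ctau _; exact: ge_bigmin_seq.
rewrite /tau big_seq; apply: le_bigmin; first exact: cg.
by move=> p pS; exact: cg.
Qed.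

Lemma tauU A B w : A != fset0 -> B != fset0 ->
  tau (A `|` B) w = Num.min (tau A w) (tau B w).
Proof.
move=> A0 B0; have AB0 : A `|` B != fset0 by rewrite fsetU_eq0 negb_and A0.
apply/le_anti; rewrite le_min; apply/andP; split; [apply/andP; split|].
- by apply/le_tauP => // p pA; have /le_tauP := lexx (tau (A `|` B) w);
    apply=> //; rewrite inE pA.
- by apply/le_tauP => // p pB; have /le_tauP := lexx (tau (A `|` B) w);
    apply=> //; rewrite inE pB orbT.
apply/le_tauP => // p; rewrite inE ge_min => /orP[pA|pB].
  by have /le_tauP -> := lexx (tau A w).
by have /le_tauP -> := lexx (tau B w); rewrite ?orbT.
Qed.

(** * Integrability over the triangle [D] *)

Local Notation mu := (@lebesgue_measure R \x @lebesgue_measure R)%E.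
Local Notation plane := (measurableTypeR R * measurableTypeR R)%type.
Let D : set plane := (@chart R @^-1` @simplex R)%classic.

Lemma chart_simplexP (x : R * R) :
  D x <-> [/\ 0 <= x.1, 0 <= x.2 & 0 <= 1 - x.1 - x.2].
Proof.
split=> [[w0 _]|[x1 x2 x3]].
  by have := (w0 0, w0 1, w0 2); rewrite !mxE /= => -[[]].
split; last by rewrite !big_ord_recl big_ord0 !mxE /=; lra.
by move=> i; rewrite mxE; case: i => -[|[|[|]]].
Qed.

Lemma measurable_chart_coord (i : 'I_3) (E : set plane) :
  measurable_fun E (fun x => chart x 0 i).
Proof.
apply: measurable_funTS; under eq_fun do rewrite mxE.
case: i => -[|[|[|]]] //= _.
- exact: measurable_fst.
- exact: measurable_snd.
- apply: measurable_funB; last exact: measurable_snd.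
  by apply: measurable_funB; [exact: measurable_cst|exact: measurable_fst].
Qed.

Lemma measurable_chart_simplex : measurable D.
Proof.
pose H i : set plane := [set x | 0 <= chart x 0 i]%classic.
have mH i : measurable (H i).
  rewrite -[H i]setTI.
  have -> : H i = ((fun x => chart x 0 i) @^-1` `[0, +oo[)%classic.
    by apply/seteqP; split => x; rewrite /H /= in_itv /= andbT.
  by apply: measurable_chart_coord => //; exact: measurable_itv.
have -> : D = (H 0 `&` H 1 `&` H 2)%classic.
  apply/seteqP; split => x; rewrite chart_simplexP /H /= !mxE /=.
    by case.
  by case=> -[].
by apply: measurableI; first exact: measurableI.
Qed.

(** The triangle lies in the unit square, which has measure one. *)
Lemma chart_simplex_finite : (mu D < +oo)%E.
Proof.
apply: (@le_lt_trans _ _ (mu (`[0, 1] `*` `[0, 1])%classic)).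
  apply: le_measure; rewrite ?inE.
  - exact: measurable_chart_simplex.
  - by apply: measurableX; exact: measurable_itv.
  - by move=> x /chart_simplexP[x1 x2 x3]; split; rewrite /= in_itv /=; lra.
rewrite product_measure1E; [|exact: measurable_itv..].
by rewrite /= lebesgue_measure_itv /= lte_fin ltr01 oppr0 adde0 mule1 ltry.
Qed.

Lemma bounded_max (f h : plane -> R) : [bounded f x | x in D] ->
  [bounded h x | x in D] -> [bounded (f \max h) x | x in D].
Proof.
apply: (@filterS2 _ (pinfty_nbhs R) _) => M fM hM x Dx /=.
by rewrite /Num.max; case: ifP => _; [exact: hM|exact: fM].
Qed.

Lemma bounded_min (f h : plane -> R) : [bounded f x | x in D] ->
  [bounded h x | x in D] -> [bounded (f \min h) x | x in D].
Proof.
apply: (@filterS2 _ (pinfty_nbhs R) _) => M fM hM x Dx /=.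
by rewrite /Num.min; case: ifP => _; [exact: fM|exact: hM].
Qed.

(** On [D], which has finite measure, this implies integrability; it is also stable under max and
    min, so it passes through the iterated definitions of [g] and [tau]. *)
Let tame (f : plane -> R) := measurable_fun D f /\ [bounded f x | x in D].

Lemma tame_coordM i (c : R) : tame (fun x => chart x 0 i * c).
Proof.
split.
  by apply: measurable_funM; [exact: measurable_chart_coord|exact: measurable_cst].
(* The coordinates of [chart x] lie between 0 and 1 on [D]. *)
exists `|c|; split; first exact: num_real.
move=> M cM x /= /chart_simplexP[x1 x2 x3].
apply: le_trans (ltW cM); rewrite normrM ler_piMl//.
rewrite mxE ler_norml.
by case: i => -[|[|[|]]] //= _; lra.
Qed.

Lemma tame_g p : tame (fun x => g p (chart x)).
Proof.
rewrite /g; elim: (index_enum _) => [|i s [mIH bIH]].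
  by under eq_fun do rewrite big_nil; exact: tame_coordM.
under eq_fun do rewrite big_cons.
have [m b] := tame_coordM i (p 0 i).
by split; [exact: measurable_maxr|exact: bounded_max].
Qed.

Lemma tame_tau S : tame (fun x => tau S (chart x)).
Proof.
(* The starting point is generalized, since the tail of the list keeps the head of the whole
   list. *)
rewrite /tau; elim: (enum_fset S) (head 0 S) => [|p s IHs] q.
  by under eq_fun do rewrite big_nil; exact: tame_g.
under eq_fun do rewrite big_cons.
have [m b] := tame_g p; have [mIH bIH] := IHs q.
by split; [exact: measurable_minr|exact: bounded_min].
Qed.

Lemma integrable_tau S : mu.-integrable D (EFin \o (fun x => tau S (chart x))).
Proof.
have [m b] := tame_tau S.
apply: measurable_bounded_integrable => //.
  exact: measurable_chart_simplex.
exact: chart_simplex_finite.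
Qed.

(** * Monotonicity and submodularity of the improvement *)

Lemma tau_decr A B w : A != fset0 -> A `<=` B -> tau B w <= tau A w.
Proof.
move=> A0 AB; have /fset0Pn[p pA] := A0.
have B0 : B != fset0 by apply/fset0Pn; exists p; exact: (fsubsetP AB).
by rewrite -(fsetUidPr _ _ AB) tauU// ge_min lexx.
Qed.

Lemma R2_decr A B : A != fset0 -> A `<=` B -> R2 B <= R2 A.
Proof.
move=> A0 AB.
apply: (le_Rintegral measurable_chart_simplex) => [||x _]; try exact: integrable_tau.
exact: tau_decr.
Qed.

Lemma R2_supermod A B p : A != fset0 -> A `<=` B ->
  R2 B - R2 (B `|` [fset p]) <= R2 A - R2 (A `|` [fset p]).
Proof.
move=> A0 AB; have /fset0Pn[q qA] := A0.
have B0 : B != fset0 by apply/fset0Pn; exists q; exact: (fsubsetP AB).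
have p0 : [fset p] != fset0 by apply/fset0Pn; exists p; rewrite inE.
rewrite /R2 -!RintegralB; try exact: integrable_tau; try exact: measurable_chart_simplex.
have integrable_gain X Y : mu.-integrable D
    (EFin \o (fun x => tau X (chart x) - tau Y (chart x))).
  exact: (integrableB measurable_chart_simplex (integrable_tau X) (integrable_tau Y)).
apply: (le_Rintegral measurable_chart_simplex) => [||x _]; try exact: integrable_gain.
rewrite !tauU//; have := tau_decr (chart x) A0 AB.
(* As [b - min(b, c) = max(b - c, 0)], the claim is that this positive part is nondecreasing in
   [b]. *)
move: (tau A _) (tau B _) (tau [fset p] _) => a b c ba.
by rewrite /Num.min; case: (ltP b c) => bc; case: (ltP a c) => ac; lra.
Qed.

Lemma improvement0 B : improvement B fset0 = 0.
Proof. by rewrite /improvement fsetU0 subrr. Qed.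

Lemma improvement_mono B S S' : B != fset0 -> S `<=` S' ->
  improvement B S <= improvement B S'.
Proof.
move=> B0 SS'; rewrite lerD2l lerN2 R2_decr ?fsetUS//.
by rewrite fsetU_eq0 negb_and B0.
Qed.

Lemma improvement_submod B S S' p : B != fset0 -> S `<=` S' ->
  improvement B (S' `|` [fset p]) - improvement B S' <=
  improvement B (S `|` [fset p]) - improvement B S.
Proof.
(* The baseline keeps the union nonempty even for [S = fset0], where greedy starts and [tau S]
   itself would be junk. *)
move=> B0 SS'; have BS0 : B `|` S != fset0 by rewrite fsetU_eq0 negb_and B0.
have := R2_supermod p BS0 (fsetUS B SS').
by rewrite /improvement !fsetUA; lra.
Qed.

End Improvement.

(* The starting value of the maximum belongs to the family, as the empty set
   is one of the sets S. *)
Theorem theorem4p4 (R : realType) (P B : {fset 'rV[R]_3}) (k : nat)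
    (Sg : {fset 'rV[R]_3})
    (P_pos : positive_points P) (B_pos : positive_points B) (B_neq0 : B != fset0)
    (k_bounds : (1 <= k <= #|` P|)%N)
    (Sg_greedy : greedy P (improvement B) k Sg) :
  improvement B Sg >=
  (1 - (expR 1)^-1) *
    \big[Num.max/improvement B fset0]_(S <- fpowerset P | (#|` S| <= k)%N)
      improvement B S.
Proof.
have /andP[k0 _] := k_bounds.
have bound O : O `<=` P -> (#|` O| <= k)%N ->
    (1 - (expR 1)^-1) * improvement B O <= improvement B Sg.
  move=> OP Ok; apply: greedy_submodular_bound k0 _ OP Ok Sg_greedy.
  - by move=> S S'; exact: improvement_mono.
  - by move=> S S' p; exact: improvement_submod.
  - exact: improvement0.
rewrite big_seq_cond.
(* The bound is carried through the iterated maximum: the starting value is the case [O = fset0],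
   and each max equals one of its two arguments. *)
elim/big_rec: _ => [|O m /andP[OP Ok] IH].
  by rewrite bound ?fsub0set ?cardfs0.
by rewrite /Num.max; case: ifP => // _; apply: bound Ok; rewrite -fpowersetE.
Qed.
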